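(* Let $f,g\in(3')$ be as in the context, with $\bar f\neq\bar g$. Let $0\le i<l\le k$ and suppose $$\bar f=u_0\cdots u_{i-1}\,(m-2)(s_i,s'_i)\,\bar g\,(m-2)(s'_{l+1},s_{l+1})\,u_{l+2}\cdots u_{k+1}y_{k+1},$$ where the word preceding $\bar g$ is non-empty, $|u_i|>1$ and $|u_{l+1}|>1$. Let $(f,g)_{\bar f}$ be the inclusion composition for this occurrence of $\bar g$. Then one of the following holds: (i) $|v_n|=1$ for all $n$, $0\le n\le q+1$, and $$(f,g)_{\bar f}\equiv u_0\cdots u_{i-1}(m-2)(s_i,s'_i)s_{l+1}x_is_{i+1}\cdots s_l\,(m-2)(s'_{l+1},s_{l+1})u_{l+2}\cdots u_{k+1}y_{k+1}-s'_0u_0\cdots u_{k+1};$$ (ii) $|v_0|=2$, $|v_n|=1$ for all $n$, $1\le n\le q+1$, and: if $m_{s_is'_i}=3$, then $(f,g)_{\bar f}\equiv0$; if $m_{s_is'_i}>3$, then $s_{l+1}=x_i$, $s'_{l+1}=s'_{i+1}=y_i$ and $$(f,g)_{\bar f}\equiv u_0\cdots u_{i-1}(m-3)(s_i,s'_i)s_{i+1}s'_{i+1}x_is_{i+1}\cdots s_l\,(m-2)(s'_{l+1},s_{l+1})u_{l+2}\cdots u_{k+1}y_{k+1}-s'_0u_0\cdots u_{k+1}.$$ Here $\equiv$ is congruence modulo $(S,\bar f)$.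
   Context: Coxeter setting. $\Sigma=\{\sigma_1,\dots,\sigma_n\}$ is finite, $(m_{ij})$ is a Coxeter matrix (symmetric, $m_{ii}=1$, $2\le m_{ij}\le\infty$ for $i\neq j$); for $s=\sigma_i,s'=\sigma_j$ write $m_{ss'}=m_{ij}$. $\Sigma^*$ is the free monoid (empty word $1$) with the deg-lex ordering (length first, then lexicographic with $\sigma_1<\dots<\sigma_n$); $|u|$ is word length; $\bar f$ is the largest word of $f\in F\langle\Sigma\rangle$, $F$ a field. For finite $m_{ss'}$, $m(s,s')$ is the alternating word $ss's\cdots$ of length $m_{ss'}$ and $(m-t)(s,s')$ the alternating word $ss's\cdots$ of length $m_{ss'}-t$ ($m$ refers to the pair in parentheses). $S$ is the union of: $(1)$ all $s^2-1$, $s\in\Sigma$; $(2)$ all $m(s,s')-m(s',s)$, $s>s'$, $m_{ss'}<\infty$; $(3')$ all $(m-1)(s_0,s_0')\cdots(m-1)(s_k,s_k')m(s_{k+1},s'_{k+1})-m(s'_0,s_0)(m-1)(s_1,s_1')\cdots(m-1)(s_{k+1},s'_{k+1})$ with $k\ge0$, $s_j,s_j'\in\Sigma$, all $m_{s_js_j'}$ finite, where for $0\le j\le k$: $s'_{j+1}=s'_j$ if $m_{s_js'_j}$ is even, $s'_{j+1}=s_j$ if it is odd; $s_0>s'_0$, $s_j<s'_j$ for $1\le j\le k+1$; $\{s_j,s'_j\}\ne\{s_{j+1},s'_{j+1}\}$ for $0\le j\le k$. Notation. $f\in(3')$ has data $s_j,s'_j$ $(0\le j\le k+1)$; $u_j=(m-1)(s_j,s'_j)$,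 $x_j$ is the last letter of $u_j$, $y_j$ the last letter of $m(s_j,s_j')$ (so $y_j=s'_{j+1}$ for $j\le k$). Thus $f=u_0\cdots u_{k+1}y_{k+1}-s'_0u_0\cdots u_{k+1}$ and $\bar f=u_0\cdots u_{k+1}y_{k+1}$. $g\in(3')$ has data $p_j,p'_j$ $(0\le j\le q+1)$, $v_j=(m-1)(p_j,p'_j)$, $z_j$ the last letter of $m(p_j,p'_j)$, $g=v_0\cdots v_{q+1}z_{q+1}-p'_0v_0\cdots v_{q+1}$, $\bar g=v_0\cdots v_{q+1}z_{q+1}$. By convention $u_0\cdots u_{i-1}=1$ if $i=0$ and $u_{l+2}\cdots u_{k+1}=1$ if $l=k$. If $\bar f=a\bar gb$, the inclusion composition is $(f,g)_{\bar f}=f-agb$. $h\equiv h'$ modulo $(S,\bar f)$ means $h-h'=\sum\alpha_ra_rs_rb_r$ with $\alpha_r\in F$, $s_r\in S$, $a_r,b_r\in\Sigma^*$, $a_r\overline{s_r}b_r<\bar f$. *)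

(* Defs.v *)
From HB Require Import structures.
From mathcomp Require Import all_boot all_order all_algebra.
From mathcomp Require Import finmap.
From mathcomp.multinomials Require Import monalg.

Set Implicit Arguments.
Unset Strict Implicit.
Unset Printing Implicit Defensive.

Import Order.TTheory GRing.Theory.

Local Open Scope ring_scope.

(* [None] stands for infinity. *)
Record coxeter_matrix (n : nat) := CoxeterMatrix {
  cox :> 'I_n -> 'I_n -> option nat;
  cox_sym : forall i j, cox i j = cox j i;
  cox_diag : forall i, cox i i = Some 1%N;
  cox_ge2 : forall i j e, i != j -> cox i j = Some e -> (2 <= e)%N
}.

(* The finite label m_{pq}; the value 0 is junk, for infinite labels. *)
Definition mval n (M : coxeter_matrix n) (p q : 'I_n) : nat := odflt 0%N (M p q).

Definition mfinite n (M : coxeter_matrix n) (p q : 'I_n) : bool := M p q != None.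

(* Words are sequences of letters. Letters are ordered by their index, and
   [seqlexi] is MathComp's lexicographic order on sequences. *)
Definition deglex n (u v : seq 'I_n) : bool :=
  (size u < size v)%N ||
  (size u == size v) && @Order.lt _ (seqlexi 'I_n) u v.

(* F<Sigma> is {malg F[{fmonom 'I_n}]}, the monoid algebra of the free monoid on
   Sigma = 'I_n; [wmon F w] is the word w as an element of it. *)
Definition wmon (F : fieldType) n (w : seq 'I_n) : {malg F[{fmonom 'I_n}]} :=
  << FMonom w >>.
Arguments wmon F {n} w.

(* The largest word of [h]; the value on [h = 0] is irrelevant. *)
Definition lead (F : fieldType) n (h : {malg F[{fmonom 'I_n}]}) : seq 'I_n :=
  foldr (fun (w : {fmonom 'I_n}) v => if deglex v w then w : seq 'I_n else v)
    [::] (msupp h).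

(* The alternating word p q p ... of length t. *)
Fixpoint altw n (t : nat) (p q : 'I_n) : seq 'I_n :=
  if t is t'.+1 then p :: altw t' q p else [::].

(* (m-t)(p,q) *)
Definition mword n (M : coxeter_matrix n) (t : nat) (p q : 'I_n) : seq 'I_n :=
  altw (mval M p q - t) p q.

(* Data (s_j, s'_j), 0 <= j <= k+1, are given as functions on [nat]; only
   their values at j <= k+1 matter. *)
Section Chains.
Variables (n : nat) (M : coxeter_matrix n) (s s' : nat -> 'I_n).

Definition blk (j : nat) : seq 'I_n := mword M 1 (s j) (s' j).

(* u_a u_{a+1} ... u_{b-1}, the empty word if b <= a. *)
Definition blks (a b : nat) : seq 'I_n := \big[cat/[::]]_(a <= j < b) blk j.

(* The last letters of u_j and of m(s_j, s'_j); the defaults are never used,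
   as m_{s_j s'_j} >= 2 in a chain. *)
Definition xlast (j : nat) : 'I_n := last (s j) (blk j).
Definition ylast (j : nat) : 'I_n := last (s j) (mword M 0 (s j) (s' j)).

Record chain (k : nat) : Prop := Chain {
  chain_finite : forall j, (j <= k.+1)%N -> mfinite M (s j) (s' j);
  chain_next : forall j, (j <= k)%N ->
    s' j.+1 = if odd (mval M (s j) (s' j)) then s j else s' j;
  chain_lt0 : (s' 0%N < s 0%N)%N;
  chain_lt : forall j, (1 <= j <= k.+1)%N -> (s j < s' j)%N;
  chain_neq : forall j, (j <= k)%N ->
    [set s j; s' j] != [set s j.+1; s' j.+1]
}.

(* [h] is the element of (3') with the given data. *)
Definition rel3 (F : fieldType) (k : nat) (h : {malg F[{fmonom 'I_n}]}) : Prop :=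
  chain k /\
  h = wmon F (blks 0 k.+1 ++ mword M 0 (s k.+1) (s' k.+1))
    - wmon F (mword M 0 (s' 0%N) (s 0%N) ++ blks 1 k.+2).

End Chains.

Inductive inS (F : fieldType) n (M : coxeter_matrix n) :
    {malg F[{fmonom 'I_n}]} -> Prop :=
| inS_square (p : 'I_n) : inS M (wmon F [:: p; p] - 1)
| inS_braid (p q : 'I_n) : (q < p)%N -> mfinite M p q ->
    inS M (wmon F (mword M 0 p q) - wmon F (mword M 0 q p))
| inS_chain (k : nat) (s s' : nat -> 'I_n) h : rel3 M s s' k h -> inS M h.

(* h = h' modulo (S, w) *)
Definition congS (F : fieldType) n (M : coxeter_matrix n) (w : seq 'I_n)
    (h h' : {malg F[{fmonom 'I_n}]}) : Prop :=
  exists (N : nat) (c : 'I_N -> F) (a b : 'I_N -> seq 'I_n)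
         (e : 'I_N -> {malg F[{fmonom 'I_n}]}),
    (forall r, inS M (e r) /\ deglex (a r ++ lead (e r) ++ b r) w) /\
    h - h' = \sum_(r < N) c r *: (wmon F (a r) * e r * wmon F (b r)).

(* The inclusion composition f - a g b. *)
Definition incl_comp (F : fieldType) n (f g : {malg F[{fmonom 'I_n}]})
    (a b : seq 'I_n) : {malg F[{fmonom 'I_n}]} :=
  f - wmon F a * g * wmon F b.

(* Main.v *)
Require Import Defs.
From HB Require Import structures.
From mathcomp Require Import all_boot all_order all_algebra.
From mathcomp Require Import finmap.
From mathcomp.multinomials Require Import monalg.
From mathcomp Require Import zify.

(** Write Y for y_i. Cancelling the common ends, the occurrence of the leading
    word of g inside that of f becomes an equality of words
      v_0 ... v_(q+1) z_(q+1) = x_i u_(i+1) ... u_l s_(l+1),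
    where m(x_i, Y) = m_i >= 3 because u_i has more than one letter, and
    likewise m_(l+1) >= 3.

    Everything follows from the monotonicity of chains. Since
    s'_(j+1) is one of s_j < s'_j, the letters of a chain from the block of
    index j >= 1 on are at most s'_j ([chain_letters_le]); and s'_j does
    occur from there on ([chain_last_mem]). Applied to f, this bounds the
    letters of the right-hand side after x_i by Y; applied to g, it bounds
    the letters from v_1 on by p'_1, which is itself one of those letters,
    hence at most Y. A look at the first two letters shows that p'_1 and p'_0
    differ from Y, so that Y does not occur after x_i at all
    ([ylast_notin_overlap]). Now a block of f with two letters or more would
    contain its s'_j, the first of which is Y: so every u_j with i < j <= l is
    the single letter s_j, which commutes with Y, and s'_j stays equal to Y
    ([overlap_blocks_f]). In contrast s_(l+1) and x_i do not commute with Y,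
    so neither occurs among s_(i+1), ..., s_l. The last letter of g is
    therefore new in the word; as a block v_j with two letters would already
    contain z_j, all blocks of g but the first are single letters
    ([overlap_blocks_g]); and v_0 cannot return to its first letter x_i, so
    that it has at most two letters ([overlap_first_block]).

    If v_0 has one letter, then p'_0 = s_(l+1) and the composition is equal to
    the announced binomial. If v_0 has two letters, then p'_0 = s_(i+1) and
    s_(l+1) = x_i; in the leading word of the composition s_(i+1) comes right
    after (m-2)(s_i, s'_i), whose last letter Y commutes with it, and exchanging
    the two gives the word announced for m_i > 3. When m_i = 3, chain monotonicity
    forces i = 0, and the three letters a = s_1 < b = s'_0 < c = s_0 satisfy
    the braid relations of type A_3. Both words of the composition are then
    rewritten to a common one ([congS_A3]). After one decreasing step, all the
    words on the way have the length of the leading word of f and begin with a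
    or b, while that word begins with c; so every relation may be used in
    either direction. *)

Set Implicit Arguments.
Unset Strict Implicit.
Unset Printing Implicit Defensive.

Import Order.TTheory GRing.Theory.

Local Open Scope ring_scope.

(** * Alternating words and Coxeter labels *)

Lemma size_altw n t (x y : 'I_n) : size (altw t x y) = t.
Proof. by elim: t x y => //= t IHt x y; rewrite IHt. Qed.

Lemma altw_rcons n t (x y : 'I_n) :
  altw t.+1 x y = rcons (altw t x y) (if odd t then y else x).
Proof.
elim: t x y => //= t IHt x y; rewrite IHt.
by case: (odd t).
Qed.

Lemma mem_altw n t (x y z : 'I_n) : z \in altw t x y -> z = x \/ z = y.
Proof.
elim: t x y => //= t IHt x y; rewrite inE => /orP[/eqP|/IHt]; by intuition.
Qed.

Lemma mval_sym n (M : coxeter_matrix n) x y : mval M x y = mval M y x.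
Proof. by rewrite /mval cox_sym. Qed.

Lemma mval_ge2 n (M : coxeter_matrix n) x y :
  mfinite M x y -> x != y -> (2 <= mval M x y)%N.
Proof.
by rewrite /mfinite /mval; case E: (M x y) => [e|] // _ neq; apply: cox_ge2 neq E.
Qed.

Lemma mfinite_mval n (M : coxeter_matrix n) x y :
  (0 < mval M x y)%N -> mfinite M x y.
Proof. by rewrite /mval /mfinite; case: (M x y). Qed.

Lemma mval_neq n (M : coxeter_matrix n) x y : (1 < mval M x y)%N -> x != y.
Proof. by apply: contraTneq => ->; rewrite /mval cox_diag. Qed.

(** * Leading words and congruence *)

Lemma deglex_asym n (u v : seq 'I_n) : deglex u v -> deglex v u = false.
Proof.
rewrite /deglex; case/orP=> [lt_uv|/andP[/eqP eq_uv lt_uv]].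
  by rewrite ltnNge (ltnW lt_uv) /= gtn_eqF.
by rewrite eq_uv ltnn eqxx /= lt_gtF.
Qed.

Lemma deglex_cat n (a b c : seq 'I_n) (x y : 'I_n) :
  (x < y)%N -> size b = size c -> deglex (a ++ x :: b) (a ++ y :: c).
Proof.
move=> lt_xy eq_bc; rewrite /deglex !size_cat /= eq_bc ltnn eqxx /=.
elim: a => [|z a IHa] /=; rewrite ltxi_cons.
  by rewrite !leEord (ltnW lt_xy) leqNgt lt_xy.
by rewrite lexx.
Qed.

(** The fold defining [lead] starts from the empty word, which is either [w] or
    below [w]; every later value has the same property, and [w] is kept from
    the moment it is met. *)
Lemma lead_eq (F : fieldType) n (h : {malg F[{fmonom 'I_n}]}) (w : seq 'I_n) :
  FMonom w \in msupp h ->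
  (forall v : {fmonom 'I_n}, v \in msupp h -> v = w :> seq _ \/ deglex v w) ->
  lead h = w.
Proof.
rewrite /lead => hw hmax.
pose P (v : seq 'I_n) := v = w \/ deglex v w.
have P0 : P [::] by rewrite /P; case: w {hw hmax P} => [|a w]; [left|right].
have: forall v : {fmonom 'I_n}, v \in (msupp h : seq _) -> P v by [].
have: FMonom w \in (msupp h : seq _) by [].
suff gen (r : seq {fmonom 'I_n}) (f := foldr
    (fun (w : {fmonom 'I_n}) v => if deglex v w then w : seq 'I_n else v)
    [::]) : (forall v : {fmonom 'I_n}, v \in r -> P v) ->
  P (f r) /\ (FMonom w \in r -> f r = w).
  by move=> hin hall; apply: (gen _ hall).2.
elim: r => [|v r IHr] hall /=; first by split.
have [Pr fr] : P (f r) /\ (FMonom w \in r -> f r = w).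
  by apply: IHr => u ur; apply: hall; rewrite inE ur orbT.
have Pv : P v by apply: hall; rewrite inE eqxx.
split; first by case: ifP.
rewrite inE; case/orP=> [/eqP <- /=|/fr ->].
  by case: Pr => [->|->] //; case: ifP.
by case: Pv => [->|/deglex_asym -> //]; case: ifP.
Qed.

Lemma lead_binomial (F : fieldType) n (u v : seq 'I_n) :
  deglex v u -> lead (wmon F u - wmon F v) = u.
Proof.
move=> lt_vu.
have neq_uv : (FMonom v == FMonom u) = false.
  by apply/eqP => -[eq_vu]; move: (deglex_asym lt_vu); rewrite eq_vu -{1}eq_vu lt_vu.
apply: lead_eq.
  by rewrite -mcoeff_neq0 mcoeffB !mcoeffU eqxx neq_uv subr0 oner_eq0.
move=> w; rewrite -mcoeff_neq0 mcoeffB !mcoeffU.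
have [<-|_] := eqVneq (FMonom u) w; first by left.
have [<-|_] := eqVneq (FMonom v) w; first by right.
by rewrite subrr eqxx.
Qed.

Lemma wmonM (F : fieldType) n (u v : seq 'I_n) :
  wmon F u * wmon F v = wmon F (u ++ v).
Proof.
rewrite /wmon malgM_def fgmulUU mulr1; congr << _ *g _ >>.
by apply/val_inj; rewrite /= fmM.
Qed.

Section Congruence.
Variables (F : fieldType) (n : nat) (M : coxeter_matrix n) (w : seq 'I_n).
Implicit Types h : {malg F[{fmonom 'I_n}]}.

Lemma congS_refl h : congS M w h h.
Proof.
exists 0%N, (fun=> 0), (fun=> [::]), (fun=> [::]), (fun=> 0).
by split=> [[]//|]; rewrite big_ord0 subrr.
Qed.

Lemma congS_sym h1 h2 : congS M w h1 h2 -> congS M w h2 h1.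
Proof.
case=> N [c] [a] [b] [e] [hS eq_h].
exists N, (fun r => - c r), a, b, e; split; first exact: hS.
rewrite -opprB eq_h -sumrN.
by apply: eq_bigr => r _; rewrite scaleNr.
Qed.

Lemma congS_trans h1 h2 h3 :
  congS M w h1 h2 -> congS M w h2 h3 -> congS M w h1 h3.
Proof.
case=> N [c] [a] [b] [e] [hS eq_h] [N'] [c'] [a'] [b'] [e'] [hS' eq_h'].
pose glue T (u : 'I_N -> T) (u' : 'I_N' -> T) (r : 'I_(N + N')) :=
  match split r with inl r1 => u r1 | inr r2 => u' r2 end.
exists (N + N')%N, (glue _ c c'), (glue _ a a'), (glue _ b b'), (glue _ e e').
split=> [r|]; first by rewrite /glue; case: split.
rewrite -(subrKA h2) eq_h eq_h' big_split_ord.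
by apply: f_equal2; apply: eq_bigr => r _; rewrite /glue
  ?(unsplitK (inl r)) ?(unsplitK (inr r)).
Qed.

Lemma congS_subr h1 h2 t : congS M w h1 h2 -> congS M w (h1 - t) (h2 - t).
Proof. by rewrite /congS opprB addrA subrK. Qed.

(** The larger word of the relation is the one that begins with the larger
    letter. *)
Lemma congS_braid a b (x y : 'I_n) : (y < x)%N -> mfinite M x y ->
  deglex (a ++ mword M 0 x y ++ b) w ->
  congS M w (wmon F (a ++ mword M 0 x y ++ b))
            (wmon F (a ++ mword M 0 y x ++ b)).
Proof.
move=> lt_yx fin_xy lt_w.
exists 1%N, (fun=> 1), (fun=> a), (fun=> b),
  (fun=> wmon F (mword M 0 x y) - wmon F (mword M 0 y x)).
split=> [_|]; last first.
  by rewrite big_ord1 scale1r mulrBr mulrBl !wmonM -!catA.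
split; first exact: inS_braid.
rewrite lead_binomial // /mword /mval !subn0 (cox_sym M x y).
have: (2 <= odflt 0%N (M y x))%N.
  move: fin_xy; rewrite /mfinite cox_sym; case E: (M y x) => [e|] //= _.
  by apply: (cox_ge2 _ E); apply: contraTneq lt_yx => ->; rewrite ltnn.
case: (odflt _ _) => [|m] //= _; apply: (@deglex_cat _ [::]) => //.
by rewrite !size_altw.
Qed.

End Congruence.

(** * The blocks of a chain *)

Section ChainWords.
Variables (n : nat) (M : coxeter_matrix n) (s s' : nat -> 'I_n).
Local Notation m j := (mval M (s j) (s' j)).
Local Notation u := (blk M s s').
Local Notation us := (blks M s s').
Local Notation x := (xlast M s s').
Local Notation y := (ylast M s s').

Lemma size_blk j : size (u j) = (m j).-1.
Proof. by rewrite /blk /mword size_altw subn1. Qed.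

Lemma ylastE j : (0 < m j)%N -> y j = if odd (m j) then s j else s' j.
Proof.
rewrite /ylast /mword subn0; case: (m j) => // t _.
by rewrite altw_rcons last_rcons /=; case: odd.
Qed.

Lemma mword0E j : (0 < m j)%N -> mword M 0 (s j) (s' j) = u j ++ [:: y j].
Proof.
move=> m_gt0; rewrite ylastE // /blk /mword subn0 subn1 cats1.
by case: (m j) m_gt0 => // t _; rewrite altw_rcons /=; case: odd.
Qed.

Lemma xlastE j : (1 < m j)%N -> x j = if odd (m j) then s' j else s j.
Proof.
rewrite /xlast /blk /mword subn1; case: (m j) => [|[|t]] // _.
by rewrite altw_rcons last_rcons /= negbK.
Qed.

Lemma blkE_xlast j : (1 < m j)%N -> u j = mword M 2 (s j) (s' j) ++ [:: x j].
Proof.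
move=> m_gt1; rewrite xlastE // /blk /mword subn1 subn2 cats1.
by case: (m j) m_gt1 => [|[|t]] // _; rewrite altw_rcons /= negbK.
Qed.

Lemma mword2E_ylast j : (2 < m j)%N ->
  mword M 2 (s j) (s' j) = mword M 3 (s j) (s' j) ++ [:: y j].
Proof.
move=> m_gt2; rewrite ylastE 1?ltnW 1?ltnW // /mword subn2 cats1.
have -> : (m j - 3 = (m j).-1.-2)%N by lia.
by case: (m j) m_gt2 => [|[|[|t]]] // _; rewrite altw_rcons /= negbK; case: odd.
Qed.

Lemma blkE_cons j : (1 < m j)%N -> u j = s j :: mword M 2 (s' j) (s j).
Proof.
rewrite /blk /mword (mval_sym M (s' j)) subn1 subn2.
by case: (m j) => [|[|t]].
Qed.

Lemma blk_unit j : m j = 2%N -> u j = [:: s j].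
Proof. by rewrite /blk /mword => ->. Qed.

Lemma mem_blk j c : c \in u j -> c = s j \/ c = s' j.
Proof. exact: mem_altw. Qed.

Lemma mem_ylast j : (0 < m j)%N -> y j = s j \/ y j = s' j.
Proof. by move=> /ylastE ->; case: odd; [left|right]. Qed.

Lemma xylast j : (1 < m j)%N ->
  (s j = x j /\ s' j = y j) \/ (s j = y j /\ s' j = x j).
Proof.
move=> m_gt1; rewrite xlastE // ylastE 1?ltnW //.
by case: odd; [right|left].
Qed.

Lemma blks_nil a b : (b <= a)%N -> us a b = [::].
Proof. by move=> ?; rewrite /blks big_geq. Qed.

Lemma blks_cons a b : (a < b)%N -> us a b = u a ++ us a.+1 b.
Proof. by move=> ?; rewrite /blks big_ltn. Qed.

Lemma blks_rcons a b : (a <= b)%N -> us a b.+1 = us a b ++ u b.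
Proof. by move=> ?; rewrite /blks big_nat_recr. Qed.

Lemma blks_cat a b c : (a <= b <= c)%N -> us a c = us a b ++ us b c.
Proof. by case/andP=> ? ?; rewrite /blks -big_cat_nat. Qed.

Lemma mem_blks a b c : reflect (exists2 r, (a <= r < b)%N & c \in u r) (c \in us a b).
Proof.
apply: (iffP idP) => [|[r ab_r c_r]].
  elim: b => [|b IHb]; first by rewrite blks_nil.
  have [ab|ba] := leqP a b; last by rewrite blks_nil.
  rewrite blks_rcons // mem_cat => /orP[/IHb[r hr c_r]|c_b].
    by exists r => //; lia.
  by exists b => //; lia.
rewrite (@blks_cat a r b); last by lia.
by rewrite mem_cat (blks_cons (a := r)) ?mem_cat ?c_r ?orbT //; lia.
Qed.

Lemma blks_unit a b : (forall r, (a <= r < b)%N -> m r = 2%N) ->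
  us a b = [seq s r | r <- index_iota a b].
Proof.
elim: b => [|b IHb] m2; first by rewrite blks_nil // /index_iota sub0n.
have [ab|ba] := leqP a b; last by rewrite blks_nil // /index_iota (eqP ba).
rewrite blks_rcons // IHb => [|r hr]; last by apply: m2; lia.
rewrite blk_unit; last by apply: m2; lia.
by rewrite /index_iota subSn // -addn1 iotaD map_cat /= subnKC.
Qed.

Variable k : nat.
Hypothesis C : chain M s s' k.

Lemma chain_m_ge2 j : (j <= k.+1)%N -> (2 <= m j)%N.
Proof.
move=> le_jk; apply: mval_ge2; first exact: (chain_finite C).
have [->|j_gt0] := posnP j.
  by apply: contraTneq (chain_lt0 C) => ->; rewrite ltnn.
have h: (1 <= j <= k.+1)%N by rewrite j_gt0.
by apply: contraTneq (chain_lt C h) => ->; rewrite ltnn.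
Qed.

Lemma chain_ylast j : (j <= k)%N -> y j = s' j.+1.
Proof.
move=> le_jk; rewrite (chain_next C) // ylastE //.
by apply: ltnW; apply: chain_m_ge2; apply: leqW.
Qed.

(** The step from s'_r to s'_(r+1) replaces s'_r by one of s_r < s'_r. The
    block of index 0 must be left out, its letters being in the opposite
    order. *)
Lemma chain_nonincr j r : (1 <= j <= r)%N -> (r <= k.+1)%N -> (s' r <= s' j)%N.
Proof.
case/andP=> j_gt0; elim: r => [|r IHr]; first by rewrite leqn0 => /eqP ->.
rewrite leq_eqVlt => /orP[/eqP -> //|lt_jr] le_rk.
apply: leq_trans (IHr _ _) => //; last exact: ltnW.
rewrite -chain_ylast //; have h: (1 <= r <= k.+1)%N by lia.
have [|->|->//] := @mem_ylast r; first by apply/ltnW/chain_m_ge2/ltnW.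
exact/ltnW/(chain_lt C).
Qed.

Lemma chain_letters_le j b c : (1 <= j)%N -> (b <= k.+2)%N ->
  c \in us j b -> (c <= s' j)%N.
Proof.
move=> j_gt0 le_bk /mem_blks[r jb_r] /mem_blk c_r.
have h: (1 <= r <= k.+1)%N by lia.
apply: (leq_trans (n := s' r)); last by apply: chain_nonincr; lia.
by case: c_r => -> //; apply/ltnW/(chain_lt C).
Qed.

Lemma chain_letters_last_le j c : (1 <= j <= k.+1)%N ->
  c \in us j k.+2 ++ [:: y k.+1] -> (c <= s' j)%N.
Proof.
case/andP=> j_gt0 le_jk; rewrite mem_cat => /orP[/chain_letters_le -> //|].
rewrite inE => /eqP ->; have h: (1 <= k.+1 <= k.+1)%N by rewrite /=.
apply: (leq_trans (n := s' k.+1)); last by apply: chain_nonincr; lia.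
have [|->|->//] := @mem_ylast k.+1; first by apply/ltnW/chain_m_ge2.
exact/ltnW/(chain_lt C).
Qed.

(** An alternating block with two letters or more contains its s'_r. As long as
    s'_j is not met, each block is thus a single letter commuting with s'_j,
    and such a block hands s'_j on to the next. *)
Lemma chain_fixed j b : (b <= k.+2)%N -> s' j \notin us j b ->
  forall r, (j <= r < b)%N -> [/\ m r = 2%N, s' r = s' j & y r = s' j].
Proof.
move=> le_bk s'j_notin r jb_r.
have unit_r t : (j <= t < b)%N -> s' t = s' j -> m t = 2%N /\ y t = s' j.
  move=> jb_t s't; have m_ge2 : (2 <= m t)%N by apply: chain_m_ge2; lia.
  have m2 : m t = 2%N.
    apply/eqP; rewrite eqn_leq m_ge2 andbT leqNgt.
    apply: contra s'j_notin => m_ge3; apply/mem_blks; exists t => //.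
    rewrite -s't /blk /mword subn1; case: (m t) m_ge3 => [|[|[|e]]] //= _.
    by rewrite !inE eqxx orbT.
  by split; rewrite // ylastE m2 //= s't.
suff s'r : s' r = s' j by have [] := unit_r r jb_r s'r.
have [d def_r] : exists d, r = (j + d)%N by exists (r - j)%N; lia.
elim: d r def_r jb_r => [|d IHd] r def_r jb_r; first by rewrite def_r addn0.
have jb_d : (j <= j + d < b)%N by lia.
have [_ <-] := unit_r _ jb_d (IHd _ (erefl _) jb_d).
by rewrite chain_ylast; [congr s'; lia|lia].
Qed.

(** If s'_j is not met in the blocks, it is handed on unchanged to the end,
    where it becomes the last letter. *)
Lemma chain_last_mem j : (j <= k.+1)%N -> s' j \in us j k.+2 ++ [:: y k.+1].
Proof.
move=> le_jk; rewrite mem_cat inE; have [//|s'j_notin] := boolP (s' j \in _).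
have [|_ _ ->] := chain_fixed (leqnn _) s'j_notin (r := k.+1); first by lia.
by rewrite eqxx.
Qed.

(** Descending from the last block: a block with two letters or more would
    contain y_r, which is the last letter of the whole word as long as all later
    blocks are single letters. *)
Lemma chain_unit j : (j <= k.+1)%N -> y k.+1 \notin us j k.+2 ->
  forall r, (j <= r <= k.+1)%N -> m r = 2%N /\ s' r = y k.+1.
Proof.
move=> le_jk z_notin.
have unit_r r : (j <= r <= k.+1)%N -> y r = y k.+1 -> m r = 2%N /\ s' r = y k.+1.
  move=> jr yr; have m_ge2 : (2 <= m r)%N by apply: chain_m_ge2; lia.
  have m2 : m r = 2%N.
    apply/eqP; rewrite eqn_leq m_ge2 andbT leqNgt.
    apply: contra z_notin => m_ge3; apply/mem_blks; exists r; first by lia.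
    rewrite -yr ylastE ?(ltnW m_ge2) // /blk /mword subn1.
    case: (m r) m_ge3 => [|[|[|e]]] //= _.
    by rewrite !inE; case: (odd _) => /=; rewrite ?eqxx ?orbT.
  by split; rewrite // -yr ylastE m2.
have all_r d : (d <= k.+1 - j)%N ->
    m (k.+1 - d)%N = 2%N /\ s' (k.+1 - d)%N = y k.+1.
  elim: d => [|d IHd] le_d; apply: unit_r; rewrite ?subn0 //; try lia.
  rewrite chain_ylast; last by lia.
  have -> : (k.+1 - d.+1).+1 = (k.+1 - d)%N by lia.
  by case: IHd => //; lia.
by move=> r jr; have := all_r (k.+1 - r)%N; rewrite subKn; [apply|]; lia.
Qed.

End ChainWords.

(** * Overlap of two chains *)

Section Overlap.
Variables (n : nat) (M : coxeter_matrix n).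
Variables (k : nat) (s s' : nat -> 'I_n) (q : nat) (p p' : nat -> 'I_n).
Hypotheses (Cs : chain M s s' k) (Cp : chain M p p' q).
Variables i l : nat.
Hypotheses (lt_il : (i < l)%N) (le_lk : (l <= k)%N).
Local Notation m j := (mval M (s j) (s' j)).
Local Notation m' j := (mval M (p j) (p' j)).
Local Notation us := (blks M s s').
Local Notation vs := (blks M p p').
Local Notation x := (xlast M s s').
Local Notation y := (ylast M s s').
Local Notation z := (ylast M p p').
Hypotheses (mi_ge3 : (3 <= m i)%N) (ml_ge3 : (3 <= m l.+1)%N).
Hypothesis overlap :
  vs 0%N q.+2 ++ [:: z q.+1] = x i :: us i.+1 l.+1 ++ [:: s l.+1].

Let T := us i.+1 l.+1 ++ [:: s l.+1].
(** v_0 without its first letter. *)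
Let rest := altw (m' 0%N - 2) (p' 0%N) (p 0%N).

Lemma overlap_behead : p 0%N = x i /\ rest ++ vs 1%N q.+2 ++ [:: z q.+1] = T.
Proof.
move: overlap; rewrite blks_cons // /blk /mword /rest /T subn1 subn2.
have: (2 <= m' 0%N)%N by apply: (chain_m_ge2 Cp).
by case: (m' 0%N) => [|[|e]] //= _ [-> <-]; rewrite catA.
Qed.

Lemma mval_xlast_ylast : mval M (x i) (y i) = m i.
Proof.
have [[-> ->]//|[-> ->]] := @xylast _ M s s' i (ltnW mi_ge3).
exact: mval_sym.
Qed.

Lemma ylast_next : y i = s' i.+1.
Proof. by apply: (chain_ylast Cs); lia. Qed.

Lemma xlast_neq_ylast : x i != y i.
Proof.
by apply: contraTneq mi_ge3 => eq_xy; rewrite -mval_xlast_ylast eq_xy /mval cox_diag.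
Qed.

Lemma overlap_letter_le c : c \in T -> (c <= y i)%N.
Proof.
rewrite ylast_next mem_cat inE => /orP[/(chain_letters_le Cs)-> //|/eqP ->].
  by lia.
apply: (leq_trans (n := s' l.+1)).
  by apply/ltnW/(chain_lt Cs); lia.
by apply: (chain_nonincr Cs); lia.
Qed.

(** No letter of g after the first can be y_i: in the rest of v_0 these are p_0
    and p'_0, and from v_1 on they are at most p'_1. If v_0 is one letter, then
    p'_0 commutes with x_i and y_i does not; otherwise p'_0 is the second letter
    s_(i+1) < y_i. And p'_1 is one of p_0, p'_0, and occurs in the overlap after
    x_i, so that it is below y_i. *)
Lemma ylast_notin_overlap : y i \notin T.
Proof.
have [p0 defT] := overlap_behead.
have m'0_ge2 : (2 <= m' 0%N)%N by apply: (chain_m_ge2 Cp).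
have p'0_neq : p' 0%N != y i.
  move: m'0_ge2; rewrite leq_eqVlt => /orP[/eqP m'0|m'0_ge3].
    by apply: contraTneq mi_ge3 => p'0; rewrite -mval_xlast_ylast -p0 -p'0 -m'0.
  have -> : p' 0%N = s i.+1.
    move: defT; rewrite /rest /T (@blks_cons _ M s s'); last by lia.
    rewrite (@blkE_cons _ M s s'); last by apply: (chain_m_ge2 Cs); lia.
    by case: (m' 0%N) m'0_ge3 => [|[|[|e]]] //= _ [->].
  have := @chain_lt _ _ _ _ _ Cs i.+1; rewrite ylast_next => lt_s.
  by apply: contraTneq (lt_s _) => [->|]; rewrite ?ltnn //; lia.
have p'1_neq : p' 1%N != y i.
  rewrite -(chain_ylast Cp) //.
  by have [|->|->] := @mem_ylast _ M p p' 0%N;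
    rewrite ?(ltnW m'0_ge2) ?p0 ?xlast_neq_ylast.
have p'1_lt : (p' 1%N < y i)%N.
  rewrite ltn_neqAle p'1_neq overlap_letter_le // -defT mem_cat.
  by rewrite (chain_last_mem Cp) ?orbT.
rewrite -defT mem_cat negb_or; apply/andP; split.
  apply/negP => /mem_altw[] /eqP; rewrite eq_sym; first exact/negP.
  by rewrite p0; apply/negP/xlast_neq_ylast.
apply: contraTN p'1_lt => /(chain_letters_last_le Cp) le.
by rewrite -leqNgt le.
Qed.

(** Since y_i = s'_(i+1) does not occur after x_i, it is handed on by single
    letters up to the block of index l+1. *)
Lemma overlap_blocks_f :
  (forall r, (i < r <= l)%N -> m r = 2%N) /\
  (forall r, (i < r <= l.+1)%N -> s' r = y i).
Proof.
have notin : s' i.+1 \notin us i.+1 l.+1.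
  by apply: contra ylast_notin_overlap; rewrite -ylast_next /T mem_cat => ->.
have fixed r : (i < r <= l)%N -> [/\ m r = 2%N, s' r = y i & y r = y i].
  by rewrite ylast_next; apply: (chain_fixed Cs _ notin); lia.
split=> r ir; first by have [] := fixed r ir.
have [le_rl|lt_lr] := leqP r l; first by have [|_ -> _] := fixed r; first by lia.
have -> : r = l.+1 by lia.
by rewrite -(chain_ylast Cs) //; have [|_ _ ->] := fixed l; first by lia.
Qed.

Lemma overlap_letters_commute c : c \in us i.+1 l.+1 -> mval M c (y i) = 2%N.
Proof.
have [unit_m fix_s'] := overlap_blocks_f.
move=> /mem_blks[r ir]; rewrite blk_unit ?unit_m // inE => /eqP ->.
by rewrite -(fix_s' r) ?unit_m //; lia.
Qed.

Lemma overlap_last : z q.+1 = s l.+1 /\ rest ++ vs 1%N q.+2 = us i.+1 l.+1.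
Proof.
have [_ defT] := overlap_behead; move: defT; rewrite catA /T !cats1.
by move/rcons_inj => [-> ->].
Qed.

(** The last letter s_(l+1) does not commute with y_i, so it differs from all
    the letters s_(i+1), ..., s_l that precede it. *)
Lemma overlap_blocks_g :
  forall r, (1 <= r <= q.+1)%N -> m' r = 2%N /\ p' r = s l.+1.
Proof.
have [zE defus] := overlap_last; rewrite -zE.
apply: (chain_unit Cp) => //; have [_ fix_s'] := overlap_blocks_f.
apply: contraTN ml_ge3 => z_in; rewrite fix_s'; last by lia.
by rewrite -zE overlap_letters_commute // -defus mem_cat z_in orbT.
Qed.

(** With three letters or more, v_0 would return to its first letter x_i, which
    does not commute with y_i although the letters s_(i+1), ..., s_l do. *)
Lemma overlap_first_block :
  m' 0%N = 2%N \/ [/\ m' 0%N = 3%N, p' 0%N = s i.+1 & s l.+1 = x i].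
Proof.
have [//|_ p'1] := @overlap_blocks_g 1%N.
have [_ defus] := overlap_last; have [p0 _] := overlap_behead.
have x_notin : x i \notin rest.
  apply: contraTN mi_ge3 => x_in; rewrite -mval_xlast_ylast overlap_letters_commute //.
  by rewrite -defus mem_cat x_in.
have : (2 <= m' 0%N)%N by apply: (chain_m_ge2 Cp).
move: x_notin defus; rewrite /rest -p0 -p'1 -(chain_ylast Cp) //.
rewrite (@blks_cons _ M s s'); last by lia.
rewrite (@blkE_cons _ M s s'); last by apply: (chain_m_ge2 Cs); lia.
case def_m: (m' 0%N) => [|[|[|[|e]]]] //=; first by left.
  by move=> _ [-> _] _; right; split=> //; rewrite ylastE def_m.
by rewrite !inE eqxx orbT.
Qed.

End Overlap.

(** * Rewriting words with a small first letter *)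

Section LowWords.
Variables (F : fieldType) (n : nat) (M : coxeter_matrix n).
Variables (c : 'I_n) (w : seq 'I_n).

(** Words of the length of [c :: w] with a first letter below [c]. They are all
    below [c :: w], and a braid relation applied after the first letter does not
    leave this set, so that there it may be used in either direction. *)
Definition low (A : seq 'I_n) : bool :=
  (size A == (size w).+1) && (head c A < c)%N.

(** Stated with an equality of [low] values so as to be an equivalence on all
    words: a sequence of rewritings then needs only one check of [low]. *)
Definition lowcong (A B : seq 'I_n) : Prop :=
  low A = low B /\ (low A -> congS M (c :: w) (wmon F A) (wmon F B)).

Lemma low_deglex A : low A -> deglex A (c :: w).
Proof.
case/andP; case: A => //= a A /eqP[eq_sz] lt_ac.
exact: (@deglex_cat _ [::]).
Qed.

Lemma lowcong_refl A : lowcong A A.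
Proof. by split=> // _; apply: congS_refl. Qed.

Lemma lowcong_sym A B : lowcong A B -> lowcong B A.
Proof. by case=> eqAB congAB; split=> [//|]; rewrite -eqAB => /congAB/congS_sym. Qed.

Lemma lowcong_trans A B C : lowcong A B -> lowcong B C -> lowcong A C.
Proof.
case=> eqAB congAB [eqBC congBC]; split; first by rewrite eqAB.
move=> lowA; apply: congS_trans (congAB lowA) (congBC _).
by rewrite -eqAB.
Qed.

Lemma lowcong_braid A B (x y : 'I_n) : x != y -> mfinite M x y ->
  low (A ++ mword M 0 x y ++ B) = low (A ++ mword M 0 y x ++ B) ->
  lowcong (A ++ mword M 0 x y ++ B) (A ++ mword M 0 y x ++ B).
Proof.
move=> neq_xy fin eq_low; split=> // lowA.
have [lt_xy|lt_yx|eq_xy] := ltngtP x y.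
- apply/congS_sym/congS_braid => //; first by rewrite /mfinite cox_sym.
  by apply: low_deglex; rewrite -eq_low.
- by apply: congS_braid => //; apply: low_deglex.
- by rewrite (val_inj eq_xy) eqxx in neq_xy.
Qed.

Lemma lowcong_braid_cons a A B (x y : 'I_n) : x != y -> mfinite M x y ->
  lowcong (a :: A ++ mword M 0 x y ++ B) (a :: A ++ mword M 0 y x ++ B).
Proof.
move=> neq_xy fin; apply: (@lowcong_braid (a :: A)) => //.
by rewrite /low /= !size_cat !size_altw mval_sym.
Qed.

Lemma lowcong_comm a A B (x y : 'I_n) : mval M x y = 2%N ->
  lowcong (a :: A ++ x :: y :: B) (a :: A ++ y :: x :: B).
Proof.
move=> mxy; have := @lowcong_braid_cons a A B x y.
rewrite /mword (mval_sym M y) mxy; apply; first by apply: (@mval_neq _ M); rewrite mxy.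
by apply: mfinite_mval; rewrite mxy.
Qed.

Lemma lowcong_braid3 a A B (x y : 'I_n) : mval M x y = 3%N ->
  lowcong (a :: A ++ x :: y :: x :: B) (a :: A ++ y :: x :: y :: B).
Proof.
move=> mxy; have := @lowcong_braid_cons a A B x y.
rewrite /mword (mval_sym M y) mxy; apply; first by apply: (@mval_neq _ M); rewrite mxy.
by apply: mfinite_mval; rewrite mxy.
Qed.

Lemma lowcong_braid3_head B (x y : 'I_n) : mval M x y = 3%N ->
  (x < c)%N -> (y < c)%N ->
  lowcong (x :: y :: x :: B) (y :: x :: y :: B).
Proof.
move=> mxy lt_xc lt_yc; have := @lowcong_braid [::] B x y.
rewrite /mword (mval_sym M y) mxy; apply; first by apply: (@mval_neq _ M); rewrite mxy.
  by apply: mfinite_mval; rewrite mxy.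
by rewrite /low /= lt_xc lt_yc.
Qed.

Lemma lowcong_pass a A R B (x : 'I_n) : {in R, forall r, mval M r x = 2%N} ->
  lowcong (a :: A ++ R ++ x :: B) (a :: A ++ x :: R ++ B).
Proof.
elim: R A => [|r R IHR] A commR; first exact: lowcong_refl.
have commR' : {in R, forall r, mval M r x = 2%N}.
  by move=> t tR; apply: commR; rewrite inE tR orbT.
have mr : mval M r x = 2%N by apply: commR; rewrite inE eqxx.
apply: lowcong_trans (lowcong_comm a A (R ++ B) mr).
by have := IHR (rcons A r) commR'; rewrite -!cats1 -!catA.
Qed.

(** Moving a letter through a chain: s'_j u_j is the alternating word
    m(s'_j, s_j), which the braid relation turns into u_j y_j, and y_j is
    s'_(j+1). *)
Lemma lowcong_chain s s' k (C : chain M s s' k) a A j : (j <= k.+1)%N ->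
  lowcong (a :: A ++ ylast M s s' j :: blks M s s' j.+1 k.+2)
          (a :: A ++ blks M s s' j.+1 k.+2 ++ [:: ylast M s s' k.+1]).
Proof.
have [d] : exists d, d = (k.+1 - j)%N by exists (k.+1 - j)%N.
elim: d j A => [|d IHd] j A def_d le_jk.
  have -> : j = k.+1 by lia.
  rewrite blks_nil //; exact: lowcong_refl.
have m_ge2 : (2 <= mval M (s j.+1) (s' j.+1))%N by apply: (chain_m_ge2 C); lia.
rewrite (@blks_cons _ M s s' j.+1); last by lia.
rewrite (chain_ylast C); last by lia.
have := @lowcong_braid_cons a A (blks M s s' j.+2 k.+2) (s' j.+1) (s j.+1).
rewrite (@mword0E _ M s s') ?(ltnW m_ge2) //.
have -> : mword M 0 (s' j.+1) (s j.+1) = s' j.+1 :: blk M s s' j.+1.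
  rewrite /blk /mword mval_sym; move: m_ge2.
  by case: (mval _ _ _) => [|t] m_ge2; [lia | rewrite subn0 subn1].
have := IHd j.+1 (A ++ blk M s s' j.+1) _ _.
rewrite -!catA /= => IH step; apply: lowcong_trans (IH _ _); try lia.
apply: step; last by apply: mfinite_mval; rewrite mval_sym ltnW.
by apply: (@mval_neq _ M); rewrite mval_sym; apply: m_ge2.
Qed.

End LowWords.

(** Both words are brought to [a b c b a R U y]. The letter [b] passes through
    [U] to become [y]; the other moves are braid relations among a, b, c, and
    commutations of b, c with [R]. *)
Lemma congS_A3 (F : fieldType) n (M : coxeter_matrix n) (a b c y : 'I_n) R U :
  (a < c)%N -> (b < c)%N -> (a < b)%N ->
  mval M a b = 3%N -> mval M b c = 3%N -> mval M a c = 2%N ->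
  {in R, forall r, mval M r b = 2%N} -> {in R, forall r, mval M r c = 2%N} ->
  let w := [:: b, a & R ++ [:: b, c & U ++ [:: y]]] in
  (forall d A, lowcong F M c w (d :: A ++ b :: U) (d :: A ++ U ++ [:: y])) ->
  congS M (c :: w) (wmon F [:: c, a, b, a & R ++ c :: U ++ [:: y]])
    (wmon F [:: b, c, b, a & R ++ [:: b, c & U]]).
Proof.
move=> lt_ac lt_bc lt_ab mab mbc mac commb commc w conj.
have mca : mval M c a = 2%N by rewrite mval_sym.
have mba : mval M b a = 3%N by rewrite mval_sym.
have mcb : mval M c b = 3%N by rewrite mval_sym.
(* The left-hand word begins with c, hence is not [low]: its first step is a
   relation in decreasing direction. *)
have first_step : congS M (c :: w)
    (wmon F [:: c, a, b, a & R ++ c :: U ++ [:: y]])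
    (wmon F [:: a, c, b, a & R ++ c :: U ++ [:: y]]).
  have := @congS_braid F n M (c :: w) [::] [:: b, a & R ++ c :: U ++ [:: y]] c a lt_ac.
  rewrite /mword mac mca; apply; first by apply: mfinite_mval; rewrite mca.
  by apply: (@deglex_cat _ [:: c]) => //=; rewrite !size_cat /= !addnS.
apply: congS_trans first_step _.
suff [_] : lowcong F M c w [:: a, c, b, a & R ++ c :: U ++ [:: y]]
    [:: b, c, b, a & R ++ [:: b, c & U]].
  by apply; rewrite /low /= lt_ac !size_cat /= !size_cat /= !addnS eqxx.
apply: (lowcong_trans (B := [:: a, b, c, b, a & R ++ U ++ [:: y]])).
  apply: (lowcong_trans (lowcong_pass F c w a [:: c; b; a] (U ++ [:: y]) commc)).
  apply: (lowcong_trans (lowcong_comm F c w a [:: c; b] (R ++ U ++ [:: y]) mac)).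
  exact: (lowcong_braid3 F c w a [::] [:: a & R ++ U ++ [:: y]] mcb).
apply: lowcong_sym.
apply: (lowcong_trans (lowcong_pass F c w b [:: c; b; a] (c :: U) commb)).
apply: (lowcong_trans (lowcong_pass F c w b [:: c; b; a; b] U commc)).
apply: (lowcong_trans (lowcong_braid3 F c w b [:: c] (c :: R ++ U) mba)).
apply: (lowcong_trans (lowcong_comm F c w b [::] [:: b, a, c & R ++ U] mca)).
apply: (lowcong_trans (lowcong_comm F c w b [:: a; c; b] (R ++ U) mac)).
apply: (lowcong_trans (lowcong_braid3 F c w b [:: a] (a :: R ++ U) mcb)).
apply: (lowcong_trans (lowcong_braid3_head F w [:: c, b, a & R ++ U] mba lt_bc lt_ac)).
apply: (lowcong_trans (lowcong_comm F c w a [:: b] [:: b, a & R ++ U] mac)).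
apply: (lowcong_trans (lowcong_braid3 F c w a [:: b; c] (R ++ U) mab)).
apply: (lowcong_trans (lowcong_sym (lowcong_pass F c w a [:: b; c; b; a] U commb))).
by have := conj a ([:: b; c; b; a] ++ R); rewrite -!catA.
Qed.

(** * The inclusion composition *)

(** The word m(s'_0, s_0) is s'_0 u_0, so both words of a chain relation are
    u_0 ... u_(k+1) with one more letter, at the right end or at the left. *)
Lemma rel3_words (F : fieldType) n (M : coxeter_matrix n) s s' k
    (h : {malg F[{fmonom 'I_n}]}) : rel3 M s s' k h ->
  let us := blks M s s' 0 k.+2 in
  let full := us ++ [:: ylast M s s' k.+1] in
  h = wmon F full - wmon F (s' 0%N :: us) /\ lead h = full.
Proof.
case=> C ->.
have m0 : (2 <= mval M (s 0%N) (s' 0%N))%N by apply: (chain_m_ge2 C).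
have mk : (2 <= mval M (s k.+1) (s' k.+1))%N by apply: (chain_m_ge2 C).
rewrite (@mword0E _ M s s' k.+1 (ltnW mk)).
rewrite catA -blks_rcons; last by [].
have -> : mword M 0 (s' 0%N) (s 0%N) = s' 0%N :: blk M s s' 0.
  rewrite /blk /mword mval_sym; case: (mval _ _ _) m0 => [|t] // _.
  by rewrite subn0 subn1.
rewrite cat_cons -blks_cons; last by [].
split; first by [].
apply: lead_binomial; rewrite blks_cons // blkE_cons //=.
by apply: (@deglex_cat _ [::]); rewrite ?(chain_lt0 C) //= !size_cat /= addn1.
Qed.

Lemma incl_comp_binomial (F : fieldType) n (A B A' B' pre post : seq 'I_n) :
  A = pre ++ A' ++ post ->
  incl_comp (wmon F A - wmon F B) (wmon F A' - wmon F B') pre post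
    = wmon F (pre ++ B' ++ post) - wmon F B.
Proof.
move=> ->; rewrite /incl_comp mulrBr mulrBl !wmonM -!catA.
by rewrite opprB addrC addrA subrK.
Qed.

Theorem theorem3p13 (F : fieldType) (n : nat) (M : coxeter_matrix n)
    (k : nat) (s s' : nat -> 'I_n) (q : nat) (p p' : nat -> 'I_n)
    (f g : {malg F[{fmonom 'I_n}]})
    (hf : rel3 M s s' k f) (hg : rel3 M p p' q g)
    (hfg : lead f <> lead g)
    (i l : nat) (hil : (i < l)%N) (hlk : (l <= k)%N) :
  let u := blk M s s' in
  let us := blks M s s' in
  let x := xlast M s s' in
  let y := ylast M s s' in
  let v := blk M p p' in
  let pre := us 0%N i ++ mword M 2 (s i) (s' i) in
  let post := mword M 2 (s' l.+1) (s l.+1) ++ us l.+2 k.+2 ++ [:: y k.+1] in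
  let fg := incl_comp f g pre post in
  let tail := wmon F (s' 0%N :: us 0%N k.+2) in
  lead f = pre ++ lead g ++ post ->
  pre <> [::] ->
  (1 < size (u i))%N ->
  (1 < size (u l.+1))%N ->
  ((forall j, (j <= q.+1)%N -> size (v j) = 1%N) /\
   congS M (lead f) fg
     (wmon F (pre ++ [:: s l.+1; x i]
                  ++ [seq s j | j <- index_iota i.+1 l.+1] ++ post)
      - tail))
  \/
  (size (v 0%N) = 2%N /\
   (forall j, (1 <= j <= q.+1)%N -> size (v j) = 1%N) /\
   (mval M (s i) (s' i) = 3%N -> congS M (lead f) fg 0) /\
   ((3 < mval M (s i) (s' i))%N ->
    s l.+1 = x i /\ s' l.+1 = y i /\ s' i.+1 = y i /\
    congS M (lead f) fg
      (wmon F (us 0%N i ++ mword M 3 (s i) (s' i)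
                 ++ [:: s i.+1; s' i.+1; x i]
                 ++ [seq s j | j <- index_iota i.+1 l.+1] ++ post)
       - tail))).
Proof.
move=> u us x y v pre post fg tail lead_f _ u_i_gt1 u_l_gt1.
have [Cs _] := hf; have [Cp _] := hg.
have mi_ge3 : (3 <= mval M (s i) (s' i))%N by rewrite size_blk in u_i_gt1; lia.
have ml_ge3 : (3 <= mval M (s l.+1) (s' l.+1))%N by rewrite size_blk in u_l_gt1; lia.
have [def_f lead_f'] := rel3_words hf; have [def_g lead_g] := rel3_words hg.
have split_us : us 0%N k.+2
    = pre ++ x i :: us i.+1 l.+1 ++ s l.+1 :: mword M 2 (s' l.+1) (s l.+1)
      ++ us l.+2 k.+2.
  rewrite /us (@blks_cat _ M s s' 0 i k.+2); last by lia.
  rewrite (@blks_cons _ M s s' i); last by lia.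
  rewrite (@blks_cat _ M s s' i.+1 l.+1 k.+2); last by lia.
  rewrite (@blks_cons _ M s s' l.+1); last by lia.
  rewrite (@blkE_xlast _ M s s' i) ?(ltnW mi_ge3) //.
  by rewrite (@blkE_cons _ M s s' l.+1) ?(ltnW ml_ge3) // -!catA.
have overlap : lead g = x i :: us i.+1 l.+1 ++ [:: s l.+1].
  have full_us : lead f = pre ++ (x i :: us i.+1 l.+1 ++ [:: s l.+1]) ++ post.
    by rewrite lead_f' -/us split_us /post -!catA /= -!catA /= -!catA.
  rewrite full_us in lead_f.
  have eq_sz : size (x i :: us i.+1 l.+1 ++ [:: s l.+1]) = size (lead g).
    by have /(congr1 size) := lead_f; rewrite !size_cat => /addnI/addIn.
  by move/eqP: lead_f; rewrite !eqseq_cat // => /and3P[_ /eqP].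
rewrite lead_g in overlap.
have p0 : p 0%N = x i by have [] := overlap_behead Cp overlap.
have [unit_m fix_s'] := overlap_blocks_f Cs Cp hil hlk mi_ge3 ml_ge3 overlap.
have unit_v := overlap_blocks_g Cs Cp hil hlk mi_ge3 ml_ge3 overlap.
have p'1 : p' 1%N = s l.+1 by have [] := unit_v 1%N.
have us_letters : us i.+1 l.+1 = [seq s j | j <- index_iota i.+1 l.+1].
  by apply: blks_unit => r ir; apply: unit_m.
have def_vs : blks M p p' 0 q.+2 = x i :: us i.+1 l.+1.
  by move: overlap; rewrite -cat_cons !cats1 => /rcons_inj[].
have def_fg : fg = wmon F (pre ++ [:: p' 0%N, x i & us i.+1 l.+1] ++ post) - tail.
  rewrite /fg def_f def_g def_vs /tail; apply: incl_comp_binomial.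
  by rewrite -lead_f' lead_f lead_g def_vs.
have start : mval M (p 0%N) (p' 0%N) = 2%N \/
    [/\ mval M (p 0%N) (p' 0%N) = 3%N, p' 0%N = s i.+1 & s l.+1 = x i]
  := overlap_first_block Cs Cp hil hlk mi_ge3 ml_ge3 overlap.
have v_unit j : (1 <= j <= q.+1)%N -> size (v j) = 1%N.
  by move=> j_in; rewrite size_blk; have [-> _] := unit_v j j_in.
case: start => [m'0|[m'0 p'0 s_l1]]; [left|right].
  split=> [[_|j le_jq]|]; first by rewrite size_blk m'0.
    exact: v_unit.
  have p'0 : p' 0%N = s l.+1.
    by rewrite -p'1 -(chain_ylast Cp) // ylastE m'0.
  by rewrite def_fg -us_letters p'0; apply: congS_refl.
have lt_p : (s i.+1 < x i)%N by rewrite -p0 -p'0; apply: chain_lt0 Cp.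
have s'_i1 : s' i.+1 = y i by rewrite fix_s' //; lia.
have s'_l1 : s' l.+1 = y i by rewrite fix_s' //; lia.
have lt_s : (s i.+1 < y i)%N by rewrite -s'_i1; apply: (chain_lt Cs); lia.
have lt_xy : (x i < y i)%N by rewrite -s_l1 -s'_l1; apply: (chain_lt Cs); lia.
have m_sy : mval M (s i.+1) (y i) = 2%N by rewrite -s'_i1 unit_m; lia.
split; first by rewrite size_blk m'0.
split; first by [].
split=> [mi3|mi_gt3]; last first.
  split; first by [].
  split; first by [].
  split; first by [].
  rewrite def_fg -us_letters /pre mword2E_ylast // s'_i1 p'0.
  apply: congS_subr.
  have := @congS_braid F n M (lead f) (us 0%N i ++ mword M 3 (s i) (s' i))
    (x i :: us i.+1 l.+1 ++ post) (y i) (s i.+1) lt_s.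
  rewrite /mword (mval_sym M (y i)) m_sy -!catA /=; apply.
    by apply: mfinite_mval; rewrite mval_sym m_sy.
  have := @deglex_cat _ pre (x i :: us i.+1 l.+1 ++ post)
    (us i.+1 l.+1 ++ s l.+1 :: post) _ _ lt_p.
  rewrite lead_f lead_g overlap /pre mword2E_ylast // /mword -!catA /=.
  by rewrite -!catA => lt; apply: lt; rewrite [in RHS]size_cat /= addnS size_cat.
(* For i > 0 the label m_i = 3 would give x_i = s'_i > s_i = y_i. *)
have i0 : i = 0%N.
  apply/eqP; rewrite -leqn0 leqNgt; apply/negP => i_gt0.
  have: (s i < s' i)%N by apply: (chain_lt Cs); lia.
  move: lt_xy; rewrite /x /y xlastE ?ylastE mi3 //=; lia.
subst i.
have [s0 s'0] : s 0%N = y 0%N /\ s' 0%N = x 0%N.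
  by rewrite /x /y xlastE ?ylastE mi3.
have m_xy : mval M (x 0%N) (y 0%N) = 3%N by rewrite (mval_xlast_ylast mi_ge3).
have m_sx : mval M (s 1%N) (x 0%N) = 3%N by rewrite mval_sym -p'0 -p0.
have def_pre : pre = [:: y 0%N].
  by rewrite /pre /us blks_nil // /mword mi3 /= s0.
have def_post : post = y 0%N :: us l.+2 k.+2 ++ [:: y k.+1].
  by rewrite /post /mword s'_l1 s_l1 mval_sym m_xy.
have def_us : us 1%N l.+1 = s 1%N :: us 2%N l.+1.
  by rewrite /us blks_cons // blk_unit ?unit_m.
have us_vs : us 2%N l.+1 = blks M p p' 1 q.+2.
  have [_] := overlap_last Cp overlap.
  by rewrite -/us def_us m'0 /= => -[_ <-].
have comm_y : {in us 2%N l.+1, forall r, mval M r (y 0%N) = 2%N}.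
  move=> r r_in; apply: (overlap_letters_commute Cs Cp hil hlk mi_ge3 ml_ge3 overlap).
  by rewrite -/us def_us inE r_in orbT.
have comm_x : {in us 2%N l.+1, forall r, mval M r (x 0%N) = 2%N}.
  rewrite us_vs => r /mem_blks[j j_in]; have [m'j p'j] := unit_v j j_in.
  by rewrite blk_unit // inE => /eqP ->; rewrite -s_l1 -p'j.
have y_l1 : y l.+1 = x 0%N.
  rewrite /y ylastE; last exact: ltnW (ltnW ml_ge3).
  by rewrite s'_l1 s_l1 m_xy.
have := @congS_A3 F n M (s 1%N) (x 0%N) (y 0%N) (y k.+1)
  (us 2%N l.+1) (us l.+2 k.+2) lt_s lt_xy lt_p m_sx m_xy m_sy comm_x comm_y.
move=> /(_ _)/= A3; rewrite def_fg -(subrr tail); apply: congS_subr.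
rewrite lead_f lead_g overlap /tail split_us def_pre def_post def_us p'0 s'0.
rewrite s_l1 /mword s'_l1 mval_sym m_xy /= -!catA /=; apply: A3 => d A.
rewrite -[in x 0%N :: us _ _]y_l1.
by apply: (lowcong_chain _ _ _ Cs); lia.
Qed.
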